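(* There exist absolute constants $c_1,c_2>0$ such that the following holds. Let $n$ be a power of $2$, let $F$ be the $n\times n$ normalized Walsh–Hadamard matrix, and let $\mathcal A_n=(M^{(0)}=\mathrm{Id},\dots,M^{(m)}=F)$ be an in-place algorithm computing $F$ with $m=(n\log n)/b$ gates for some $b\ge1$. Then at least one of the following holds: (i) (Severe overflow) there exist an integer $n'\ge c_1 n$, an orthonormal system $v_1,\dots,v_{n'}\in\mathbb R^n$, integers $t_1,\dots,t_{n'}\in[m]$ and $i_1,\dots,i_{n'}\in[n]$ such that for all $j\in[n']$, $M^{(t_j)}(i_j,:)\,P_j=\alpha_j v_j^T$ with $\alpha_j\ge c_2\sqrt b$, where $P_j$ is the orthogonal projection onto the orthogonal complement of $\mathrm{span}\{v_1,\dots,v_{j-1}\}$; (ii) (Severe underflow) there exist an integer $n'\ge c_1 n$, an orthonormal system $u_1,\dots,u_{n'}\in\mathbb R^n$, integers $t_1,\dots,t_{n'}\in[m]$ and $i_1,\dots,i_{n'}\in[n]$ such that for all $j\in[n']$, $(M^{(t_j)})^{-T}(i_j,:)\,Q_j=\gamma_j u_j^T$ with $\gamma_j\ge c_2\sqrt b$, where $Q_j$ is the orthogonal projection onto the orthogonal complement of $\mathrm{span}\{u_1,\dots,u_{j-1}\}$. In either case, the gates at times $t_1,\dots,t_{n'}$ are rotations, for each $j\in[n']$ the index $i_j$ is one of the two coordinates affected by the $t_j$-th gate, and the set $\{t_1,\dots,t_{n'}\}$ has cardinality at least $n'/2$.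
   Context: An in-place algorithm on $\mathbb R^n$ is a sequence of gates applied to a machine state in $\mathbb R^n$ (initially the input $x$). Each gate is either a rotation, which replaces a pair of coordinates $(i,j)$ by the image under a $2\times2$ matrix $\begin{pmatrix}\cos\theta&\sin\theta\\-\sin\theta&\cos\theta\end{pmatrix}$, or a constant gate, which multiplies a single coordinate by a nonzero constant. $M^{(t)}\in\mathbb R^{n\times n}$ is the (nonsingular) matrix such that $M^{(t)}x$ is the machine state after the first $t$ gates; $M^{(0)}=\mathrm{Id}$, and $m$ is the number of gates. $[m]=\{1,\dots,m\}$. For a matrix $A$, $A(i,:)$ denotes its $i$-th row (a row vector), and $A^{-T}=(A^{-1})^T$. Logarithms are base $2$. The normalized Walsh–Hadamard matrix is $F(k,\ell)=n^{-1/2}(-1)^{\langle[k-1],[\ell-1]\rangle}$, where $[p]$ is the binary representation of $p\in\{0,\dots,n-1\}$ as a vector of $\log_2 n$ bits. *)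

(* Defs.v *)
From HB Require Import structures.
From mathcomp Require Import all_boot all_order all_algebra.
From mathcomp Require Import reals exp trigo.
From mathcomp Require Import ring.

Set Implicit Arguments.
Unset Strict Implicit.
Unset Printing Implicit Defensive.

Import Order.TTheory GRing.Theory Num.Theory.
Local Open Scope ring_scope.

Definition log2 (R : realType) (x : R) : R := ln x / ln 2.

Section Algorithms.
Variables (R : realType) (n : nat).

Inductive gate : Type :=
  | Rotation (i j : 'I_n) (neq_ij : i != j) (theta : R)
  | Constant (i : 'I_n) (c : R) (c_neq0 : c != 0).

Definition is_rotation (g : gate) : bool :=
  if g is Rotation _ _ _ _ then true else false.

Definition affected (g : gate) : {set 'I_n} :=
  match g with
  | Rotation i j _ _ => [set i; j]
  | Constant i _ _ => [set i]
  end.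

(* A machine state is a column vector ([p = 1]); for general [p] the gate is
   applied simultaneously to the [p] states that are the columns of [A]. *)
Definition apply_gate (p : nat) (A : 'M[R]_(n, p)) (g : gate) : 'M[R]_(n, p) :=
  match g with
  | Rotation i j _ theta => \matrix_(k, l)
      if k == i then cos theta * A i l + sin theta * A j l
      else if k == j then - sin theta * A i l + cos theta * A j l
      else A k l
  | Constant i c _ => \matrix_(k, l) if k == i then c * A i l else A k l
  end.

Definition state_after (p : nat) (gs : seq gate) (t : nat) (A : 'M[R]_(n, p)) :
    'M[R]_(n, p) :=
  foldl (@apply_gate p) A (take t gs).

(* The columns are the states reached from the standard basis vectors, so this
   is M^(t); see [state_afterE] and [state_mx_unit]. *)
Definition state_mx (gs : seq gate) (t : nat) : 'M[R]_n :=
  state_after gs t 1%:M.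

Lemma apply_gateM p q (A : 'M[R]_(n, p)) (B : 'M[R]_(p, q)) g :
  apply_gate (A *m B) g = apply_gate A g *m B.
Proof.
case: g => [i j nij th|i c c0]; apply/matrixP => k l; rewrite !mxE.
  have [->|ki] := eqVneq k i; last have [->|kj] := eqVneq k j.
  - rewrite !mulr_sumr -big_split; apply: eq_bigr => x _ /=.
    by rewrite mxE eqxx; ring.
  - rewrite !mulr_sumr -big_split; apply: eq_bigr => x _ /=.
    by rewrite mxE eqxx eq_sym (negPf nij); ring.
  - by apply: eq_bigr => x _; rewrite mxE (negPf ki) (negPf kj).
have [->|ki] := eqVneq k i.
  by rewrite mulr_sumr; apply: eq_bigr => x _; rewrite mxE eqxx mulrA.
by apply: eq_bigr => x _; rewrite mxE (negPf ki).
Qed.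

Lemma state_afterE p gs t (x : 'M[R]_(n, p)) :
  state_after gs t x = state_mx gs t *m x.
Proof.
rewrite /state_mx /state_after -{1}(mul1mx x).
elim: (take t gs) (1%:M : 'M[R]_n) => //= g s IHs A.
by rewrite apply_gateM IHs.
Qed.

Lemma apply_gate_unit (A : 'M[R]_n) g :
  A \in unitmx -> apply_gate A g \in unitmx.
Proof.
move=> uA; rewrite -(mul1mx A) apply_gateM unitmx_mul uA andbT.
pose g' := match g with
  | Rotation i j nij th => Rotation nij (- th)
  | Constant i c c0 => @Constant i c^-1 (etrans (congr1 negb (invr_eq0 c)) c0)
  end.
have : apply_gate 1%:M g' *m apply_gate 1%:M g = 1%:M.
  rewrite -apply_gateM mul1mx /g'.
  case: g {g'} => [i j nij th|i c c0]; apply/matrixP => k l; rewrite !mxE.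
    rewrite !eqxx (eq_sym j i) (negPf nij) cosN sinN.
    have cs := cos2Dsin2 th.
    have [->|ki] := eqVneq k i; last have [->|kj] := eqVneq k j => //.
      by rewrite -[RHS]mul1r -cs; ring.
    by rewrite -[RHS]mul1r -cs; ring.
  by have [->|ki] := eqVneq k i; rewrite // eqxx mulrA mulVf ?mul1r.
by case/mulmx1_unit.
Qed.

Lemma state_mx_unit gs t : state_mx gs t \in unitmx.
Proof.
rewrite /state_mx /state_after.
have: (1%:M : 'M[R]_n) \in unitmx by exact: unitmx1.
by elim: (take t gs) (1%:M : 'M[R]_n) => //= g s IHs A /(apply_gate_unit g)/IHs.
Qed.

End Algorithms.

(* Bit [s] of [p] has weight [2 ^ s]. *)
Definition bits (k p : nat) : {ffun 'I_k -> bool} :=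
  [ffun s : 'I_k => odd (p %/ 2 ^ s)].

Definition bits_dot (k : nat) (x y : {ffun 'I_k -> bool}) : nat :=
  (\sum_(s < k) x s * y s)%N.

(* The 0-based row and column indices are the integers whose binary
   representations are paired. *)
Definition walsh_hadamard (R : realType) (k : nat) : 'M[R]_(2 ^ k) :=
  \matrix_(p, q)
    ((Num.sqrt (2 ^ k)%:R)^-1 * (-1) ^+ bits_dot (bits k p) (bits k q)).

Section Orthogonality.
Variables (R : realType) (n : nat).

Definition orthonormal_system (N : nat) (v : 'I_N -> 'cV[R]_n) : Prop :=
  forall j k, (v j)^T *m v k = ((j == k)%:R)%:M.

(* As in [mxalgebra], a subspace of R^n is the row space of a matrix. *)
Definition orthocompl (m : nat) (W : 'M[R]_(m, n)) : 'M[R]_n := kermx W^T.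

(* [orthoproj W] acts on row vectors by right multiplication; being symmetric,
   it is also the matrix of the projection acting on column vectors. *)
Definition orthoproj (W : 'M[R]_n) : 'M[R]_n := proj_mx W (orthocompl W).

Definition span_before (N : nat) (v : 'I_N -> 'cV[R]_n) (j : 'I_N) : 'M[R]_n :=
  (\sum_(k < N | (k < j)%N) <<(v k)^T>>)%MS.

Definition proj_away (N : nat) (v : 'I_N -> 'cV[R]_n) (j : 'I_N) : 'M[R]_n :=
  orthoproj (orthocompl (span_before v j)).

Lemma capmx_orthocompl (W : 'M[R]_n) : (W :&: orthocompl W = 0)%MS.
Proof.
apply/eqP; rewrite -submx0; apply/rV_subP => u.
rewrite sub_capmx => /andP[/submxP[w uE] /sub_kermxP uW].
have: u *m u^T = 0 by rewrite {2}uE trmx_mul mulmxA uW mul0mx.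
move/matrixP/(_ 0 0); rewrite !mxE => /eqP.
rewrite psumr_eq0 => [/allP u0|x _]; last by rewrite mxE -expr2 sqr_ge0.
suff -> : u = 0 by rewrite sub0mx.
apply/rowP => x; have := u0 x (mem_index_enum _).
by rewrite !mxE mulf_eq0 orbb => /eqP.
Qed.

Lemma orthoproj_id (W : 'M[R]_n) (x : 'rV[R]_n) :
  (x <= W)%MS -> x *m orthoproj W = x.
Proof. exact/proj_mx_id/capmx_orthocompl. Qed.

Lemma orthoproj_0 (W : 'M[R]_n) (x : 'rV[R]_n) :
  (x <= orthocompl W)%MS -> x *m orthoproj W = 0.
Proof. exact/proj_mx_0/capmx_orthocompl. Qed.

End Orthogonality.

(* With [X t = M^(t)] this is severe overflow, with [X t = (M^(t))^-T] severe
   underflow.  Gate times are 0-based: [t j : 'I_m] is the gate performed at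
   time [(t j).+1], which turns M^(t j) into M^((t j).+1). *)
Definition severe_growth (R : realType) (n m : nat) (gs : m.-tuple (gate R n))
    (X : nat -> 'M[R]_n) (c1 c2 b : R) : Prop :=
  exists (N : nat) (v : 'I_N -> 'cV[R]_n) (t : 'I_N -> 'I_m) (i : 'I_N -> 'I_n)
      (alpha : 'I_N -> R),
    [/\ c1 * n%:R <= N%:R /\ orthonormal_system v,
        forall j, row (i j) (X (t j).+1) *m proj_away v j = alpha j *: (v j)^T
                  /\ c2 * Num.sqrt b <= alpha j,
        forall j, is_rotation (tnth gs (t j)),
        forall j, i j \in affected (tnth gs (t j)) &
        N%:R / 2 <= #|[set t j | j : 'I_N]|%:R :> R].

Definition severe_overflow (R : realType) (n m : nat)
    (gs : m.-tuple (gate R n)) (c1 c2 b : R) : Prop :=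
  severe_growth gs (fun t => state_mx gs t) c1 c2 b.

Definition severe_underflow (R : realType) (n m : nat)
    (gs : m.-tuple (gate R n)) (c1 c2 b : R) : Prop :=
  severe_growth gs (fun t => (invmx (state_mx gs t))^T) c1 c2 b.

(* Main.v *)
(* The proof follows the quasi-entropy [- sum x ln |x|], where [x] ranges over
   the entrywise products of [M^(t) P] and [(M^(t))^-T Q], and [P], [Q] project
   away the overflow directions [v_j] and underflow directions [u_j] found so
   far.  While there are at most [n / 900] of each, the quasi-entropy is at most
   about [n ln n / 2] for [M = Id] and close to [n ln n] for [M = F], whose
   entries have constant modulus.  A constant gate leaves it unchanged.  A
   rotation of two rows keeps the sums [x + x'] in each column, so it changes the
   quasi-entropy by at most a constant times the squared norms of the affected
   rows.  Since there are only [n log n / b] gates, after some rotation an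
   affected row of [M P] or of [M^-T Q] has squared norm at least a constant
   times [b]; normalizing it gives the next [v_j] or [u_j]. *)
Require Import Defs.
From mathcomp Require Import all_boot all_order all_algebra.
From mathcomp Require Import reals exp trigo.
From mathcomp Require Import ring lra.

Import Order.TTheory GRing.Theory Num.Theory.
Local Open Scope ring_scope.

Set Implicit Arguments.
Unset Strict Implicit.
Unset Printing Implicit Defensive.

(** * Elementary bounds for the function - x ln |x| *)

Section Entropy.
Variable R : realType.
Implicit Types x y T : R.

Definition ent x : R := - x * ln `|x|.

Lemma ln_leB1 x : 0 < x -> ln x <= x - 1.
Proof. by move=> x0; rewrite -{1}[x](subrKC 1) le_ln1Dx //; lra. Qed.

Lemma ent0 : ent 0 = 0.
Proof. by rewrite /ent oppr0 mul0r. Qed.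

Lemma entN x : ent (- x) = - ent x.
Proof. by rewrite /ent normrN mulNr. Qed.

Lemma ent_ge0 x : 0 <= x <= 1 -> 0 <= ent x.
Proof.
move=> /andP[x0 x1]; rewrite /ent mulNr -mulrN mulr_ge0 // oppr_ge0.
by apply: ln_le0; rewrite ger0_norm.
Qed.

Lemma ent_le1B x : 0 <= x -> ent x <= 1 - x.
Proof.
rewrite le_eqVlt => /predU1P[<-|x0]; first by rewrite ent0; lra.
rewrite /ent gtr0_norm // mulNr -mulrN -lnV ?posrE //.
have h : ln x^-1 <= x^-1 - 1 by rewrite ln_leB1 ?invr_gt0.
apply: (le_trans (ler_wpM2l (ltW x0) h)).
by rewrite mulrBr mulfV ?gt_eqF // mulr1.
Qed.

Lemma ent_norm_le1 x : `|x| <= 1 -> `|ent x| <= 1.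
Proof.
wlog x0 : x / 0 <= x => [H|].
  have [/H//|x0] := leP 0 x; rewrite -normrN => /H.
  by rewrite entN normrN; apply; lra.
rewrite (ger0_norm x0) => x1; rewrite ger0_norm ?ent_ge0 ?x0 //.
by rewrite (le_trans (ent_le1B x0)) //; lra.
Qed.

Lemma entM T x : 0 < T -> ent (T * x) = T * ent x - T * x * ln T.
Proof.
move=> T0; have [->|x0] := eqVneq x 0.
  by rewrite mulr0 ent0 mulr0 mul0r subrr.
rewrite /ent normrM (gtr0_norm T0) lnM ?posrE ?normr_gt0 //; ring.
Qed.

(* Scaling all four arguments by [T] only adds a linear term, which cancels
   because the two sums agree. *)
Lemma ent_exchange x1 x2 y1 y2 T :
  x1 + x2 = y1 + y2 ->
  `|x1| <= T -> `|x2| <= T -> `|y1| <= T -> `|y2| <= T ->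
  (ent y1 + ent y2) - (ent x1 + ent x2) <= 4 * T.
Proof.
move=> exy hx1 hx2 hy1 hy2.
have : 0 <= T by apply: le_trans hx1.
rewrite le_eqVlt => /predU1P[T0|T0].
  move: hx1 hx2 hy1 hy2; rewrite -T0 !normr_le0.
  by move=> /eqP-> /eqP-> /eqP-> /eqP->; rewrite ent0; lra.
have sc z : `|z| <= T -> exists2 w, z = T * w & `|ent w| <= 1.
  move=> hz; exists (z / T); first by field; rewrite gt_eqF.
  by apply: ent_norm_le1; rewrite normrM normfV (gtr0_norm T0) ler_pdivrMr ?mul1r.
move: (sc _ hx1) (sc _ hx2) (sc _ hy1) (sc _ hy2).
move=> [a ax /ler_normlP[a1 a2]] [b bx /ler_normlP[b1 b2]].
move=> [c cy /ler_normlP[c1 c2]] [d dy /ler_normlP[d1 d2]].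
have -> : ent y1 + ent y2 - (ent x1 + ent x2) =
    T * (ent c + ent d - ent a - ent b) - (y1 + y2 - (x1 + x2)) * ln T.
  by rewrite ax bx cy dy !entM //; ring.
by rewrite exy subrr mul0r subr0 mulrC ler_pM2r //; lra.
Qed.

Lemma ln_ge_half (n : R) : 2 <= n -> 1 / 2 <= ln n.
Proof.
move=> n2; have := @ln_leB1 n^-1; rewrite invr_gt0 lnV ?posrE; last by lra.
have : n^-1 <= 2^-1 by rewrite lef_pV2 ?posrE //; lra.
by move=> h1 h2; have := h2 ltac:(lra); lra.
Qed.

(** As ln n >= 1/2, the right side is at least 2 |y - 1|. This covers negative y through [ent_le1B]
    and [1, 2] through ln y <= y - 1. On [0, 1] the left side is nonpositive, and beyond 2 one has y
    <= 2 (y - 1) and ln y <= ln n. *)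
Lemma xlnx_le (n y : R) : 2 <= n -> y <= n ->
  y * ln `|y| <= 4 * `|y - 1| * ln n.
Proof.
move=> n2 yn; have ln2 := ln_ge_half n2.
have [y0|y0] := ltP y 0.
  have := @ent_le1B (- y); rewrite entN /ent => h.
  have {}h := h ltac:(lra).
  rewrite [`|y - 1|]ltr0_norm; last by lra.
  by nra.
have [y1|y1] := leP y 1.
  apply: (@le_trans _ _ 0); last by rewrite !mulr_ge0 //; lra.
  by have := @ent_ge0 y; rewrite y0 y1 /ent => /(_ isT); lra.
rewrite (gtr0_norm (lt_trans ltr01 y1)) ger0_norm; last by lra.
have [y2|y2] := leP y 2.
  have h : ln y <= y - 1 by rewrite ln_leB1 //; lra.
  by nra.
have h : ln y <= ln n by rewrite ler_ln ?posrE //; lra.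
by nra.
Qed.

(** Applying [xlnx_le] to y = n x and unscaling with [entM] bounds [ent x] below by x ln n - 4 |x -
    1/n| ln n. Replacing x ln n by (1/n) ln n costs the fifth multiple. *)
Lemma ent_near_uniform (n x : R) : 2 <= n -> x <= 1 ->
  n^-1 * ln n - 5 * `|x - n^-1| * ln n <= ent x.
Proof.
move=> n2 x1; have n0 : 0 < n by lra.
have ln0 : 0 <= ln n by apply: ln_ge0; lra.
have := @xlnx_le n (n * x) n2; rewrite -[leRHS]mulr1 ler_pM2l // => /(_ x1).
have -> : n * x - 1 = n * (x - n^-1) by field; rewrite gt_eqF.
rewrite [`|n * (_ - _)|]normrM (gtr0_norm n0).
have -> : n * x * ln `|n * x| = - (n * ent x - n * x * ln n).
  by rewrite -entM // /ent; ring.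
move=> h.
have {}h : x * ln n - 4 * `|x - n^-1| * ln n <= ent x.
  by rewrite -(ler_pM2l n0); lra.
apply: le_trans h.
have : (n^-1 - x) * ln n <= `|x - n^-1| * ln n.
  by rewrite ler_wpM2r // distrC ler_norm.
lra.
Qed.

(* The cut-off [n ^ 3] makes the additive error negligible when the bound is
   summed over the [n ^ 2] entries of a matrix. *)
Lemma ent_small (n x : R) : 1 <= n -> - 1 <= x ->
  ent x <= 3 * `|x| * ln n + (n ^+ 3)^-1.
Proof.
move=> n1 x1; have n0 : 0 < n by lra.
have n3 : 0 < n ^+ 3 by rewrite exprn_gt0.
have ln0 : 0 <= ln n by apply: ln_ge0.
have [x0|x0] := ltP x 0.
  apply: (@le_trans _ _ 0).
    rewrite -[x]opprK entN oppr_le0; apply: ent_ge0; lra.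
  by rewrite addr_ge0 ?invr_ge0 ?(ltW n3) // !mulr_ge0.
rewrite (ger0_norm x0).
have := @ent_le1B (n ^+ 3 * x); rewrite mulr_ge0 ?(ltW n3) // => /(_ isT).
rewrite entM // lnXn // => h.
rewrite -(ler_pM2l n3) mulrDr mulfV ?gt_eqF //.
have : 0 <= n ^+ 3 * x by rewrite mulr_ge0 ?(ltW n3).
move: h; rewrite -mulr_natr; lra.
Qed.

End Entropy.

(** * The quasi-entropy and its change under a single gate *)

Section Potential.
Variables (R : realType) (n : nat).
Implicit Types (A B V P : 'M[R]_n) (g : gate R n) (gs : seq (gate R n)).

Definition potential A B : R := \sum_i \sum_l ent (A i l * B i l).

Definition row_sqnorm A i : R := \sum_l A i l ^+ 2.

(** The effect of a gate on the inverse transpose: a rotation matrix is its own inverse transpose,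
    while the factor c turns into its inverse. *)
Definition dual_gate g : gate R n :=
  match g with
  | Rotation i j nij th => Rotation nij th
  | Constant i c c0 => @Constant R n i c^-1 (etrans (congr1 negb (invr_eq0 c)) c0)
  end.

Lemma dual_gateP A B g :
  (apply_gate A g)^T *m apply_gate B (dual_gate g) = A^T *m B.
Proof.
apply/matrixP => x y; rewrite !mxE.
case: g => [i j nij th|i c c0] /=; last first.
  apply: eq_bigr => k _; rewrite !mxE.
  by have [->|//] := eqVneq k i; field.
have nji : j != i by rewrite eq_sym.
rewrite (bigD1 i) //= (bigD1 j) //= [RHS](bigD1 i) //= [X in _ = _ + X](bigD1 j) //=.
rewrite !addrA; congr (_ + _); last first.
  by apply: eq_bigr => k /andP[ki kj]; rewrite !mxE (negPf ki) (negPf kj).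
rewrite !mxE !eqxx (negPf nji).
transitivity ((cos th ^+ 2 + sin th ^+ 2) * (A i x * B i y + A j x * B j y)).
  by ring.
by rewrite cos2Dsin2 mul1r.
Qed.

Lemma rotation_sqnorm (a b th : R) :
  (cos th * a + sin th * b) ^+ 2 + (- sin th * a + cos th * b) ^+ 2
  = a ^+ 2 + b ^+ 2.
Proof.
transitivity ((cos th ^+ 2 + sin th ^+ 2) * (a ^+ 2 + b ^+ 2)); first by ring.
by rewrite cos2Dsin2 mul1r.
Qed.

Lemma normM_le_sqr (a b : R) : `|a * b| <= (a ^+ 2 + b ^+ 2) / 2.
Proof.
have := sqr_ge0 (`|a| - `|b|); rewrite normrM sqrrB !real_normK ?num_real //.
by rewrite -mulr_natr; lra.
Qed.

(** Rows other than i and j cancel. In each column the rotation preserves the inner product of the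
    two pairs of entries, so the two products keep their sum and [ent_exchange] applies. *)
Lemma potential_rotation A B (i j : 'I_n) (nij : i != j) th :
  potential (apply_gate A (Rotation nij th)) (apply_gate B (Rotation nij th)) -
    potential A B <=
  2 * (row_sqnorm (apply_gate A (Rotation nij th)) i +
       row_sqnorm (apply_gate A (Rotation nij th)) j +
       row_sqnorm (apply_gate B (Rotation nij th)) i +
       row_sqnorm (apply_gate B (Rotation nij th)) j).
Proof.
have nji : j != i by rewrite eq_sym.
rewrite /potential [X in X - _](bigD1 i) //= [X in _ + X - _](bigD1 j) //=.
rewrite [X in _ - X](bigD1 i) //= [X in _ - (_ + X)](bigD1 j) //=.
rewrite [X in _ + (_ + X) - _](eq_bigr (fun k => \sum_l ent (A k l * B k l))); last first.
  by move=> k /andP[ki kj]; apply: eq_bigr => l _; rewrite !mxE (negPf ki) (negPf kj).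
set rest := \sum_(k | _) _; rewrite !addrA opprD addrACA subrr addr0.
rewrite /row_sqnorm -!big_split -sumrB mulr_sumr /=; apply: ler_sum => l _.
rewrite !mxE !eqxx (negPf nji).
have hA := rotation_sqnorm (A i l) (A j l) th.
have hB := rotation_sqnorm (B i l) (B j l) th.
have dot : A i l * B i l + A j l * B j l =
    (cos th * A i l + sin th * A j l) * (cos th * B i l + sin th * B j l) +
    (- sin th * A i l + cos th * A j l) * (- sin th * B i l + cos th * B j l).
  transitivity ((cos th ^+ 2 + sin th ^+ 2) * (A i l * B i l + A j l * B j l)).
    by rewrite cos2Dsin2 mul1r.
  by ring.
move: dot hA hB.
move: (cos th * A i l + _) (- sin th * A i l + _) => a a'.
move: (cos th * B i l + _) (- sin th * B i l + _) => b b' dot hA hB.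
have s x := sqr_ge0 (x : R).
have sA := (s (A i l), s (A j l)); have sB := (s (B i l), s (B j l)).
have sa := (s a, s a'); have sb := (s b, s b').
(* AM-GM bounds each new product by T, and each old one too, since the rotation preserves the sum of
   squares of each pair. *)
pose T := (a ^+ 2 + a' ^+ 2 + b ^+ 2 + b' ^+ 2) / 2.
have -> : 2 * (a ^+ 2 + a' ^+ 2 + b ^+ 2 + b' ^+ 2) = 4 * T by rewrite /T; field.
move: (sA.1) (sA.2) (sB.1) (sB.2) (sa.1) (sa.2) (sb.1) (sb.2) => *.
apply: (@ent_exchange _ _ _ _ _ T); rewrite ?dot //.
all: apply: le_trans (normM_le_sqr _ _) _; rewrite /T; lra.
Qed.

Lemma potential_constant A B (i : 'I_n) c (c0 : c != 0) :
  let G := @Constant R n i c c0 in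
  potential (apply_gate A G) (apply_gate B (dual_gate G)) = potential A B.
Proof.
apply: eq_bigr => k _; apply: eq_bigr => l _; rewrite !mxE.
by have [->|//] := eqVneq k i; congr ent; field.
Qed.

Lemma potential_gate A B g D :
  (is_rotation g -> forall i, i \in affected g ->
     row_sqnorm (apply_gate A g) i <= D /\
     row_sqnorm (apply_gate B (dual_gate g)) i <= D) -> 0 <= D ->
  potential (apply_gate A g) (apply_gate B (dual_gate g)) <= potential A B + 8 * D.
Proof.
case: g => [i j nij th|i c c0] h D0; last by rewrite potential_constant; lra.
have [] := (h isT i, h isT j); rewrite !inE !eqxx orbT.
move=> /(_ isT)[ai bi] /(_ isT)[aj bj].
by have := potential_rotation A B nij th; rewrite /= in ai aj bi bj *; lra.
Qed.

Lemma state_mxS gs t g0 : (t < size gs)%N ->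
  state_mx gs t.+1 = apply_gate (state_mx gs t) (nth g0 gs t).
Proof.
by move=> h; rewrite /state_mx /state_after (take_nth g0) // -cats1 foldl_cat.
Qed.

Lemma invmx_state_mx gs t :
  (invmx (state_mx gs t))^T = state_mx (map dual_gate gs) t.
Proof.
have h : (state_mx gs t)^T *m state_mx (map dual_gate gs) t = 1%:M.
  rewrite /state_mx /state_after -map_take.
  elim/last_ind: (take t gs) => [|s g IH] /=; first by rewrite trmx1 mulmx1.
  by rewrite map_rcons -!cats1 !foldl_cat /= dual_gateP.
have u : (state_mx gs t)^T \in unitmx by rewrite unitmx_tr state_mx_unit.
by rewrite trmx_inv -[RHS]mul1mx -(mulVmx u) -mulmxA h mulmx1.
Qed.

(** P and Q act from the right and gates from the left, so the gates act directly on the projected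
    matrices and the one-gate bounds add up. *)
Lemma potential_growth m (gs : m.-tuple (gate R n)) P Q D : 0 <= D ->
  (forall (t : 'I_m) i,
     is_rotation (tnth gs t) -> i \in affected (tnth gs t) ->
     row_sqnorm (state_mx gs t.+1 *m P) i <= D /\
     row_sqnorm ((invmx (state_mx gs t.+1))^T *m Q) i <= D) ->
  potential (state_mx gs m *m P) ((invmx (state_mx gs m))^T *m Q)
  <= potential P Q + m%:R * (8 * D).
Proof.
move=> D0 h; rewrite invmx_state_mx.
suff H t : (t <= m)%N -> potential (state_mx gs t *m P)
    (state_mx (map dual_gate gs) t *m Q) <= potential P Q + t%:R * (8 * D).
  exact: H.
elim: t => [_|t IH tm].
  by rewrite /state_mx /state_after !take0 /= !mul1mx mul0r addr0.
(* Only a default value for [nth]. *)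
have g0 := tnth gs (Ordinal tm).
have ts : (t < size gs)%N by rewrite size_tuple.
have := h (Ordinal tm); rewrite invmx_state_mx (tnth_nth g0) /=.
rewrite !(state_mxS g0) ?size_map // (nth_map g0) // -!apply_gateM => {}h.
apply: le_trans (potential_gate (D := D) _ D0) _.
  by move=> rg i /(h i rg).
by have := IH (ltnW tm); rewrite -natr1; lra.
Qed.

End Potential.

(** * Orthogonal projectors, and the potential at the identity and at a flat orthogonal matrix *)

Section Projectors.
Variables (R : realType) (n : nat).
Implicit Types (A F U V : 'M[R]_n).

Definition projector V := V^T = V /\ V *m V = V.

Lemma sum_const_ord (c : R) : \sum_(i < n) c = n%:R * c.
Proof. by rewrite sumr_const card_ord mulr_natl. Qed.

Lemma mxtrace_mulT A : \tr (A *m A^T) = \sum_i \sum_j A i j ^+ 2.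
Proof.
apply: eq_bigr => i _; rewrite mxE.
by apply: eq_bigr => j _; rewrite mxE expr2.
Qed.

Lemma projector_diag V i : projector V -> V i i = \sum_j V i j ^+ 2.
Proof.
move=> [VT VV]; rewrite -{1}VV -{2}VT mxE.
by apply: eq_bigr => j _; rewrite mxE expr2.
Qed.

Lemma projector_sqr_le_diag V i j : projector V -> V i j ^+ 2 <= V i i.
Proof.
move=> pV; rewrite (projector_diag i pV) (bigD1 j) //= lerDl.
by apply: sumr_ge0 => k _; rewrite sqr_ge0.
Qed.

Lemma projector_diag_itv V i : projector V -> 0 <= V i i <= 1.
Proof.
move=> pV; have h := projector_sqr_le_diag i i pV.
have h0 : 0 <= V i i by apply: le_trans h; rewrite sqr_ge0.
by rewrite h0 /= leNgt; apply/negP => h1; nra.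
Qed.

Lemma norm_le1_sqr (x : R) : x ^+ 2 <= 1 -> `|x| <= 1.
Proof. by rewrite -real_normK ?num_real // expr_le1. Qed.

Lemma projector_norm_le1 V i j : projector V -> `|V i j| <= 1.
Proof.
move=> pV; apply: norm_le1_sqr; apply: le_trans (projector_sqr_le_diag i j pV) _.
by case/andP: (projector_diag_itv i pV).
Qed.

Lemma mxtrace_projector V : projector V -> \tr V = \sum_i \sum_j V i j ^+ 2.
Proof. by move=> pV; apply: eq_bigr => i _; apply: projector_diag. Qed.

Lemma projectorC V : projector V -> projector (1%:M - V).
Proof.
move=> [VT VV]; split; first by rewrite linearB /= trmx1 VT.
by rewrite mulmxBl mul1mx mulmxBr mulmx1 VV subrr subr0.
Qed.

(** F V F^T is again a projector, and its diagonal entry at i is the squared norm of row i of F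
    V. *)
Lemma orthogonal_projector_le1 F V i j :
  F *m F^T = 1%:M -> projector V -> `|(F *m V) i j| <= 1.
Proof.
move=> FF pV; have [VT VV] := pV.
have FTF : F^T *m F = 1%:M by apply: mulmx1C.
have pW : projector (F *m V *m F^T).
  split; first by rewrite !trmx_mul trmxK VT mulmxA.
  by rewrite !mulmxA -(mulmxA (F *m V) F^T F) FTF mulmx1 -(mulmxA F V V) VV.
apply: norm_le1_sqr; apply: (@le_trans _ _ ((F *m V *m F^T) i i)); last first.
  by case/andP: (projector_diag_itv i pW).
have -> : F *m V *m F^T = (F *m V) *m (F *m V)^T.
  by rewrite trmx_mul VT mulmxA -(mulmxA F V V) VV.
move: (F *m V) => W; rewrite mxE (bigD1 j) //= mxE -expr2 lerDl.
by apply: sumr_ge0 => k _; rewrite mxE -expr2 sqr_ge0.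
Qed.

Lemma sqnorm_orthogonal_projector F V : F *m F^T = 1%:M -> projector V ->
  \sum_i \sum_j (F *m V) i j ^+ 2 = \tr V.
Proof.
move=> FF [VT VV]; rewrite -mxtrace_mulT trmx_mul VT mulmxA -(mulmxA F V V) VV.
by rewrite mxtrace_mulC mulmxA (mulmx1C FF) mul1mx.
Qed.

(** With U = V = 0 every product is 1/n and the potential is n ln n. The loss caused by U and V is
    controlled by the total deviation of the products from 1/n, which the small traces bound. *)
Lemma potential_flat F U V : (2 <= n)%N -> F *m F^T = 1%:M ->
  (forall i j, F i j ^+ 2 = n%:R^-1) -> projector U -> projector V ->
  \tr U <= n%:R / 900 -> \tr V <= n%:R / 900 ->
  n%:R * ln n%:R * (13 / 20) <=
  potential (F *m (1%:M - U)) (F *m (1%:M - V)).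
Proof.
move=> n2 FF Fn pU pV tU tV.
have N2 : 2 <= n%:R :> R by rewrite ler_nat.
have N0 : n%:R != 0 :> R by rewrite pnatr_eq0 -lt0n ltnW.
have L0 : 0 <= ln n%:R :> R by apply: ln_ge0; lra.
(* The weight 30 is the square root of the trace ratio 900: it balances
   [|F| ^ 2 = n] against [|F *m U| ^ 2 <= n / 900]. *)
have am (a b : R) : `|a * b| <= (a ^+ 2 / 30 + 30 * b ^+ 2) / 2.
  have := sqr_ge0 (`|a| - 30 * `|b|).
  rewrite normrM -(real_normK (num_real a)) -(real_normK (num_real b)).
  by rewrite !expr2; lra.
(* With f, a, b the entries of F, F U, F V, the deviation is - f a - f b + a b: the weighted AM-GM
   handles the first two terms, the plain one the last. *)
pose E i j := (n%:R^-1 / 30 + 31 * (F *m U) i j ^+ 2 / 2 + 31 * (F *m V) i j ^+ 2 / 2).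
have FE i j : n%:R^-1 * ln n%:R - 5 * E i j * ln n%:R <=
   ent ((F *m (1%:M - U)) i j * (F *m (1%:M - V)) i j).
  have h1 : (F *m (1%:M - U)) i j * (F *m (1%:M - V)) i j <= 1.
    apply: le_trans (ler_norm _) _; rewrite normrM mulr_ile1 //.
      exact/orthogonal_projector_le1/projectorC.
    exact/orthogonal_projector_le1/projectorC.
  apply: le_trans (ent_near_uniform N2 h1).
  rewrite lerD2l lerN2 ler_wpM2r // ler_wpM2l //.
  rewrite !mulmxBr !mulmx1 -(Fn i j) /E -(Fn i j) !mxE.
  move: (\sum_k _) (\sum_k _) => b a; set f := F i j.
  have -> : (f - a) * (f - b) - f ^+ 2 = - (f * a) - f * b + a * b by ring.
  apply: le_trans (ler_normD _ _) _; have h2 := ler_normD (- (f * a)) (- (f * b)).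
  have := (am f a, am f b, normM_le_sqr a b).
  by move: h2; rewrite !normrN => h2 [[h3 h4] h5]; lra.
apply: (@le_trans _ _
  (\sum_i \sum_j (n%:R^-1 * ln n%:R - 5 * E i j * ln n%:R))); last first.
  by apply: ler_sum => i _; apply: ler_sum => j _; apply: FE.
(* The sum is at most n/30 + 31 n/900; five times 61/900 is below 7/20, which leaves 13/20. *)
have sE : \sum_i \sum_j E i j <= n%:R * (61 / 900).
  rewrite /E.
  under eq_bigr do
    rewrite !big_split /= sum_const_ord -!mulr_suml -!mulr_sumr.
  rewrite !big_split /= sum_const_ord -!mulr_suml -!mulr_sumr.
  rewrite (sqnorm_orthogonal_projector FF pU) (sqnorm_orthogonal_projector FF pV).
  have -> : n%:R * (n%:R * (n%:R^-1 / 30)) = n%:R / 30 :> R by field.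
  by lra.
under eq_bigr do rewrite sumrB sum_const_ord -mulr_suml -mulr_sumr.
rewrite sumrB sum_const_ord -mulr_suml -mulr_sumr.
have -> : n%:R * (n%:R * (n%:R^-1 * ln n%:R)) = n%:R * ln n%:R :> R by field.
have : 0 <= n%:R * ln n%:R :> R by rewrite mulr_ge0.
by have := ler_wpM2r L0 sE; lra.
Qed.

(** On the diagonal, [ent_le1B] leaves at most U_ii + V_ii; off it, [ent_small] and AM-GM leave
    squares, which sum to traces. The cut-off errors sum to 1/n <= 1/2 <= (n ln n)/2, the main share
    of 51/100. *)
Lemma potential_id U V : (2 <= n)%N -> projector U -> projector V ->
  \tr U <= n%:R / 900 -> \tr V <= n%:R / 900 ->
  potential (1%:M - U) (1%:M - V) <= n%:R * ln n%:R * (51 / 100).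
Proof.
move=> n2 pU pV tU tV.
have N2 : 2 <= n%:R :> R by rewrite ler_nat.
have N0 : n%:R != 0 :> R by rewrite pnatr_eq0 -lt0n ltnW.
have L0 : 1 / 2 <= ln n%:R :> R by apply: ln_ge_half.
pose E i j := (i == j)%:R * (U i i + V i i) +
  (3 / 2 * ln n%:R * (U i j ^+ 2 + V i j ^+ 2) + (n%:R ^+ 3)^-1).
apply: (@le_trans _ _ (\sum_i \sum_j E i j)).
  apply: ler_sum => i _; apply: ler_sum => j _; rewrite /E !mxE.
  have s1 := sqr_ge0 (U i j); have s2 := sqr_ge0 (V i j).
  have n3 : 0 <= (n%:R ^+ 3)^-1 :> R by rewrite invr_ge0 exprn_ge0.
  have [->|ij] := eqVneq i j; rewrite ?mul1r ?mul0r ?add0r ?sub0r.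
    have /andP[u0 u1] := projector_diag_itv j pU.
    have /andP[v0 v1] := projector_diag_itv j pV.
    rewrite mulr1n; apply: le_trans (ent_le1B _) _; first by rewrite mulr_ge0; lra.
    have : 0 <= 3 / 2 * ln n%:R * (U j j ^+ 2 + V j j ^+ 2).
      by rewrite mulr_ge0 ?mulr_ge0 ?addr_ge0 ?sqr_ge0 //; lra.
    by nra.
  rewrite mulrNN; apply: le_trans (ent_small (n := n%:R) _ _) _; first by lra.
    have : `|U i j * V i j| <= 1 by rewrite normrM mulr_ile1 ?projector_norm_le1.
    by move/ler_normlP => []; lra.
  rewrite lerD2r; have := normM_le_sqr (U i j) (V i j) => h.
  have -> : 3 / 2 * ln n%:R * (U i j ^+ 2 + V i j ^+ 2) =
    3 * ((U i j ^+ 2 + V i j ^+ 2) / 2) * ln n%:R by field.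
  by rewrite ler_wpM2r ?ler_wpM2l //; lra.
have -> : \sum_i \sum_j E i j = \tr U + \tr V +
   (3 / 2 * ln n%:R * (\tr U + \tr V) + n%:R^-1).
  rewrite {2}(mxtrace_projector pU) {2}(mxtrace_projector pV) /E.
  under eq_bigr do rewrite !big_split /= sum_const_ord -mulr_sumr big_split /=.
  rewrite !big_split /= sum_const_ord -mulr_sumr big_split /=.
  congr (_ + (_ + _)).
    rewrite /mxtrace -big_split; apply: eq_bigr => i _ /=.
    rewrite (bigD1 i) //= eqxx mul1r big1 ?addr0 // => j ji.
    by rewrite eq_sym (negPf ji) mul0r.
  by field.
have : n%:R^-1 <= 2^-1 :> R by rewrite lef_pV2 ?posrE //; lra.
have : (\tr U + \tr V) * ln n%:R <= n%:R * (2 / 900) * ln n%:R.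
  by rewrite ler_wpM2r //; lra.
have : n%:R * (1 / 2) <= n%:R * ln n%:R :> R by rewrite ler_wpM2l //; lra.
by lra.
Qed.

End Projectors.

(** * Orthogonality and constant modulus of the Walsh-Hadamard matrix *)

Section WalshHadamard.
Variables (R : realType) (k : nat).

Lemma eq_by_bits l p q : (p < 2 ^ l)%N -> (q < 2 ^ l)%N ->
  (forall s, (s < l)%N -> odd (p %/ 2 ^ s) = odd (q %/ 2 ^ s)) -> p = q.
Proof.
elim: l p q => [|l IH] p q; first by rewrite expn0 !ltnS !leqn0 => /eqP-> /eqP->.
rewrite expnS => hp hq h; have h0 := h 0%N isT; rewrite expn0 !divn1 in h0.
rewrite -(odd_double_half p) -(odd_double_half q) h0; congr (_ + _.*2)%N.
apply: IH => [||s sl]; rewrite -?divn2 ?ltn_divLR // 1?mulnC //.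
by rewrite -!divnMA mulnC -expnSr h.
Qed.

Lemma bits_bij : bijective (fun p : 'I_(2 ^ k) => bits k p).
Proof.
apply: inj_card_bij => [p q /ffunP e|]; last first.
  by rewrite card_ffun card_bool !card_ord.
apply: val_inj; apply: (@eq_by_bits k) => [||s sk]; try exact: ltn_ord.
by have := e (Ordinal sk); rewrite !ffunE.
Qed.

(** The sum over all bit vectors factors into a product over bit positions; a position where x and y
    differ contributes 1 - 1 = 0. *)
Lemma sum_characters (x y : {ffun 'I_k -> bool}) :
  \sum_f (-1) ^+ bits_dot x f * (-1) ^+ bits_dot y f = (2 ^ k)%:R * (x == y)%:R :> R.
Proof.
transitivity (\prod_(s < k) \sum_(c : bool) (-1) ^+ (x s * c) * (-1) ^+ (y s * c) : R).
  rewrite bigA_distr_bigA; apply: eq_bigr => f _.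
  by rewrite /bits_dot !expr_sum -big_split.
have [->|xy] := eqVneq x y.
  rewrite mulr1 natrX -[in RHS](card_ord k) -prodr_const; apply: eq_bigr => s _.
  rewrite big_bool /= -!exprD !addnn -!mul2n !exprM sqrrN !expr1n; lra.
have [s xys] : exists s, x s != y s.
  apply/existsP; rewrite -negb_forall; apply: contra xy => /forallP e.
  by apply/eqP/ffunP => s; apply/eqP.
rewrite mulr0 (bigD1 s) //= big_bool /= !muln1 !muln0 !expr0.
by case: (x s) (y s) xys => [] [] //= _; rewrite expr1 expr0; lra.
Qed.

Lemma walsh_hadamard_sqr i j : walsh_hadamard R k i j ^+ 2 = (2 ^ k)%:R^-1.
Proof.
rewrite mxE exprMn exprVn sqr_sqrtr ?ler0n // -exprM mulnC exprM sqrrN.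
by rewrite !expr1n mulr1.
Qed.

Lemma walsh_hadamard_orthogonal :
  walsh_hadamard R k *m (walsh_hadamard R k)^T = 1%:M.
Proof.
apply/matrixP => p q; rewrite !mxE.
have nz : (2 ^ k)%:R != 0 :> R by rewrite pnatr_eq0 -lt0n expn_gt0.
have e : (bits k p == bits k q) = (p == q) by rewrite (bij_eq bits_bij).
transitivity ((2 ^ k)%:R^-1 * ((2 ^ k)%:R * (p == q)%:R) : R); last by rewrite mulKf.
rewrite -e -sum_characters mulr_sumr.
rewrite [RHS](reindex (fun p : 'I_(2 ^ k) => bits k p)) /=; last exact/onW_bij/bits_bij.
by apply: eq_bigr => r _; rewrite !mxE mulrACA -expr2 exprVn sqr_sqrtr ?ler0n.
Qed.

End WalshHadamard.

(** * Explicit projectors onto spans of orthonormal vectors *)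

Section Frames.
Variables (R : realType) (n : nat).
Implicit Types (v : nat -> 'cV[R]_n) (V W : 'M[R]_n).

(** For orthonormal vectors this is the projector onto their span. Indexing by [nat] lets a vector
    be appended without changing types. *)
Definition frame v N : 'M[R]_n := \sum_(l < N) v l *m (v l)^T.

Definition orthonormal_upto v N :=
  forall j k, (j < N)%N -> (k < N)%N -> (v j)^T *m v k = ((j == k)%:R)%:M.

Lemma orthonormal_upto_le v M N :
  (M <= N)%N -> orthonormal_upto v N -> orthonormal_upto v M.
Proof. by move=> MN ov j k jM kM; apply: ov; apply: leq_trans MN. Qed.

Lemma frame_mul v N k : orthonormal_upto v N -> (k < N)%N ->
  frame v N *m v k = v k.
Proof.
move=> ov kN; rewrite /frame mulmx_suml (bigD1 (Ordinal kN)) //=.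
rewrite -mulmxA ov // eqxx mulmx1 big1 ?addr0 // => l lk.
rewrite -mulmxA ov //; have /negPf-> : l != k :> nat by [].
by rewrite mul_mx_scalar scale0r.
Qed.

Lemma frame_tr v N : (frame v N)^T = frame v N.
Proof. by rewrite linear_sum /=; apply: eq_bigr => l _; rewrite trmx_mul trmxK. Qed.

Lemma mul_frame v N k : orthonormal_upto v N -> (k < N)%N ->
  (v k)^T *m frame v N = (v k)^T.
Proof. by move=> ov kN; rewrite -frame_tr -trmx_mul frame_mul. Qed.

Lemma frame_projector v N : orthonormal_upto v N -> projector (frame v N).
Proof.
move=> ov; split; first exact: frame_tr.
rewrite {2}/frame mulmx_sumr; apply: eq_bigr => l _.
by rewrite mulmxA frame_mul.
Qed.

Lemma mxtrace_frame v N : orthonormal_upto v N -> \tr (frame v N) = N%:R.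
Proof.
move=> ov; rewrite linear_sum /= -[in RHS](card_ord N) -sumr_const.
by apply: eq_bigr => l _; rewrite mxtrace_mulC ov // eqxx mxtrace1.
Qed.

(** Split x as x (1 - V) + x V: the first part lies in the complement of W, where the projection is
    the identity, and the second in the complement of that complement, where it vanishes. *)
Lemma orthoproj_orthocompl V W : projector V -> (W == V)%MS ->
  orthoproj (orthocompl W) = 1%:M - V.
Proof.
move=> [VT VV] /andP[/submxP[D WE] /submxP[E VE]].
have VC : (1%:M - V) *m V = 0 by rewrite mulmxBl mul1mx VV subrr.
apply/row_matrixP => i; rewrite !rowE; move: (delta_mx _ _) => x.
rewrite -[in LHS](subrK (x *m V) x) mulmxDl -{1}(mulmx1 x) -mulmxBr.
rewrite orthoproj_id; last first.
  by apply/sub_kermxP; rewrite WE trmx_mul VT mulmxA -(mulmxA x) VC mulmx0 mul0mx.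
rewrite orthoproj_0 ?addr0 //; apply/sub_kermxP.
have kV : kermx W^T *m V = 0 by rewrite -VT VE trmx_mul mulmxA mulmx_ker mul0mx.
by rewrite -mulmxA -{1}VT -trmx_mul kV trmx0 mulmx0.
Qed.

Lemma span_before_frame v N (j : 'I_N) : orthonormal_upto v N ->
  (span_before (fun l : 'I_N => v l) j == frame v j)%MS.
Proof.
move=> /(orthonormal_upto_le (ltnW (ltn_ord j))) ov; apply/andP; split.
  apply/sumsmx_subP => l lj; rewrite genmxE -(mul_frame ov lj).
  exact: submxMl.
apply: summx_sub => l _; apply: submx_trans (submxMl _ _) _.
have lN : (l < N)%N by apply: ltn_trans (ltn_ord j).
by apply: (sumsmx_sup (Ordinal lN)); rewrite /= ?genmxE.
Qed.

Lemma proj_away_frame v N (j : 'I_N) : orthonormal_upto v N ->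
  proj_away (fun l : 'I_N => v l) j = 1%:M - frame v j.
Proof.
move=> ov; apply: orthoproj_orthocompl; last exact: span_before_frame.
exact/frame_projector/(orthonormal_upto_le (ltnW (ltn_ord j))).
Qed.

End Frames.

(** * Extending an orthonormal system of large projected rows *)

Section Greedy.
Variables (R : realType) (n m : nat) (gs : m.-tuple (gate R n)).
Variables (X : nat -> 'M[R]_n) (a : R) (a_gt0 : 0 < a).
Implicit Types (v : nat -> 'cV[R]_n) (t : nat -> 'I_m) (i : nat -> 'I_n).

(** The data of [severe_growth] in extendable form: sequences over [nat], of which only the first N
    terms matter, with [frame] in place of [proj_away]. *)
Definition growing_system N v t i (alpha : nat -> R) :=
  orthonormal_upto v N /\
  forall j, (j < N)%N ->
    [/\ row (i j) (X (t j).+1) *m (1%:M - frame v j) = alpha j *: (v j)^T,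
        a <= alpha j, is_rotation (tnth gs (t j)) & i j \in affected (tnth gs (t j))].

Lemma eq_frame v v' N : (forall j, (j < N)%N -> v j = v' j) -> frame v N = frame v' N.
Proof. by move=> e; apply: eq_bigr => l _; rewrite e. Qed.

Lemma growing_system_extend N v t i alpha (t0 : 'I_m) (i0 : 'I_n) :
  growing_system N v t i alpha ->
  is_rotation (tnth gs t0) -> i0 \in affected (tnth gs t0) ->
  a ^+ 2 <= row_sqnorm (X t0.+1 *m (1%:M - frame v N)) i0 ->
  exists v' t' i' alpha', growing_system N.+1 v' t' i' alpha'.
Proof.
move=> [ov gr] rot aff; set w := row i0 (X t0.+1) *m (1%:M - frame v N).
have -> : row_sqnorm (X t0.+1 *m (1%:M - frame v N)) i0 = (w *m w^T) 0 0.
  rewrite /row_sqnorm mxE; apply: eq_bigr => l _.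
  by rewrite /w -row_mul !mxE expr2.
set q := _ 0 0 => aq.
have a2 : 0 < a ^+ 2 by rewrite exprn_gt0.
have q0 : 0 < q by apply: lt_le_trans aq.
(* The new coefficient is the norm of the projected row w, and the new vector is w normalized; w is
   orthogonal to all earlier vectors. *)
pose al := Num.sqrt q.
have al2 : al ^+ 2 = q by rewrite sqr_sqrtr // ltW.
have al0 : 0 < al by rewrite sqrtr_gt0.
have aal : a <= al by rewrite -ler_sqr ?nnegrE ?al2 // ltW.
pose upd T (f : nat -> T) (y : T) j := if j == N then y else f j.
have updN T (f : nat -> T) y : upd T f y N = y by rewrite /upd eqxx.
have updE T (f : nat -> T) y j : (j < N)%N -> upd T f y j = f j.
  by move=> jN; rewrite /upd ltn_eqF.
exists (upd _ v (al^-1 *: w^T)), (upd _ t t0), (upd _ i i0), (upd _ alpha al).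
have fr j : (j <= N)%N -> frame (upd _ v (al^-1 *: w^T)) j = frame v j.
  by move=> jN; apply: eq_frame => l lj; rewrite updE // (leq_trans lj).
have wv k : (k < N)%N -> w *m v k = 0.
  by move=> kN; rewrite -mulmxA mulmxBl mul1mx frame_mul // subrr mulmx0.
have vT : (al^-1 *: w^T)^T = al^-1 *: w by rewrite linearZ /= trmxK.
have ww : w *m w^T = q%:M by rewrite [LHS]mx11_scalar.
split; last first.
  move=> j; rewrite ltnS leq_eqVlt => /predU1P[->|jN]; last first.
    by rewrite fr ?(ltnW jN) // !updE //; apply: gr.
  rewrite fr // !updN; split=> //.
  by rewrite vT scalerA mulfV ?scale1r ?gt_eqF.
move=> j k; rewrite ltnS leq_eqVlt => /predU1P[->|jN];
  rewrite ltnS leq_eqVlt => /predU1P[->|kN].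
- rewrite !updN eqxx vT -scalemxAl -scalemxAr ww.
  by rewrite !scale_scalar_mx -al2 expr2 mulKf ?mulVf ?gt_eqF.
- rewrite updN updE // vT -scalemxAl wv // scaler0.
  by rewrite gtn_eqF // raddf0.
- rewrite updN updE // -scalemxAr -trmx_mul wv // trmx0 scaler0.
  by rewrite ltn_eqF // raddf0.
- by rewrite !updE // ov.
Qed.

(** Since v_k is orthogonal to the earlier vectors, projecting the common row r at stage j or at
    stage k leaves its inner product with v_k unchanged. Stage j gives 0 and stage k gives alpha_k >
    0. *)
Lemma growing_system_inj N v t i alpha j k : growing_system N v t i alpha ->
  (j < k)%N -> (k < N)%N -> t j = t k -> i j = i k -> False.
Proof.
move=> [ov gr] jk kN ejt eji; have jN := ltn_trans jk kN.
have [ej _ _ _] := gr _ jN; have [ek aak _ _] := gr _ kN.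
rewrite ejt eji in ej; move: ej ek; set r := row _ _ => ej ek.
have fk M : (M <= k)%N -> frame v M *m v k = 0.
  move=> Mk; rewrite /frame mulmx_suml big1 // => l _.
  have lk : (l < k)%N by apply: leq_trans Mk.
  rewrite -mulmxA ov //; last exact: ltn_trans kN.
  by rewrite ltn_eqF // mul_mx_scalar scale0r.
have rv M : (M <= k)%N -> r *m (1%:M - frame v M) *m v k = r *m v k.
  by move=> Mk; rewrite -mulmxA mulmxBl mul1mx fk // subr0.
have := rv _ (ltnW jk); rewrite -(rv k) // ej ek -!scalemxAl !ov // eqxx ltn_eqF //.
move/matrixP/(_ 0 0); rewrite !mxE eqxx !mulr1n mulr0 mulr1 => e.
by have := lt_le_trans a_gt0 aak; rewrite -e ltxx.
Qed.

Lemma card_affected g : (#|affected (n := n) (R := R) g| <= 2)%N.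
Proof.
case: g => [i j ij th|i c c0] /=; rewrite ?cards2 ?cards1 //.
by case: (_ != _).
Qed.

Lemma severe_growth_of_system N v t i alpha c1 c2 b :
  a = c2 * Num.sqrt b -> growing_system N v t i alpha ->
  c1 * n%:R <= N%:R -> severe_growth gs X c1 c2 b.
Proof.
move=> ae sys cN; have [ov gr] := sys.
exists N, (fun j => v j), (fun j => t j), (fun j => i j), (fun j => alpha j).
split=> [|j|j|j|]; first by split=> // j k; rewrite ov.
- by have [e al _ _] := gr _ (ltn_ord j); rewrite proj_away_frame // -ae.
- by have [] := gr _ (ltn_ord j).
- by have [] := gr _ (ltn_ord j).
rewrite ler_pdivrMr // -natrM ler_nat.
set T := [set _ | j : 'I_N].
(* Count the indices j by their time: those sharing a time have distinct rows by
   [growing_system_inj], all among the at most two affected coordinates. *)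
have -> : N = (\sum_(j < N) 1)%N by rewrite sum1_card card_ord.
rewrite (partition_big (fun j : 'I_N => t j) (mem T)) /=; last first.
  by move=> j _; apply: imset_f.
rewrite -sum_nat_const; apply: leq_sum => t0 _; rewrite sum1_card.
rewrite -(@card_in_imset _ _ (fun j : 'I_N => i j)); last first.
  move=> j k; rewrite !unfold_in => /eqP ej /eqP ek eik; apply: val_inj.
  have etk : t j = t k by apply: val_inj; rewrite ej ek.
  have [jk|kj|//] := ltngtP (val j) (val k).
    by case: (growing_system_inj sys jk (ltn_ord k) etk eik).
  by case: (growing_system_inj sys kj (ltn_ord j) (esym etk) (esym eik)).
apply: leq_trans (card_affected (tnth gs t0)); apply/subset_leq_card/subsetP.
move=> x /imsetP[j]; rewrite unfold_in => /eqP/val_inj <- ->.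
by have [] := gr _ (ltn_ord j).
Qed.

End Greedy.

(** * Existence of a large projected row, and the iteration *)

(** The potential must rise by (13/20 - 51/100) n ln n = (14/100) n ln n. If all affected rows were
    small after every rotation, m gates adding at most 8 a^2 each could not achieve this. *)
Lemma row_sqnorm_bound (R : realType) n m (gs : m.-tuple (gate R n))
    (a : R) r u (v w : nat -> 'cV[R]_n) :
  (2 <= n)%N -> 0 < a -> orthonormal_upto v r -> orthonormal_upto w u ->
  r%:R <= n%:R / 900 :> R -> u%:R <= n%:R / 900 :> R ->
  state_mx gs m *m (state_mx gs m)^T = 1%:M ->
  (forall i j, state_mx gs m i j ^+ 2 = n%:R^-1) ->
  m%:R * (8 * a ^+ 2) < n%:R * ln n%:R * (14 / 100) ->
  exists (t : 'I_m) i, [/\ is_rotation (tnth gs t), i \in affected (tnth gs t) &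
    a ^+ 2 <= row_sqnorm (state_mx gs t.+1 *m (1%:M - frame v r)) i \/
    a ^+ 2 <= row_sqnorm ((invmx (state_mx gs t.+1))^T *m (1%:M - frame w u)) i].
Proof.
move=> n2 a0 ov ow rn un; set F := state_mx gs m => FF Fn small.
have pv := frame_projector ov; have pw := frame_projector ow.
rewrite -(mxtrace_frame ov) in rn; rewrite -(mxtrace_frame ow) in un.
(* By orthogonality both factors of the final potential come from F, as [potential_flat]
   requires. *)
have invF : (invmx F)^T = F.
  have uF : F \in unitmx by case: (mulmx1_unit FF).
  by rewrite -[invmx F]mulmx1 -FF mulmxA mulVmx // mul1mx trmxK.
have hF := potential_flat n2 FF Fn pv pw rn un.
have h1 := potential_id n2 pv pw rn un.
pose big t (i : 'I_n) :=
  (a ^+ 2 <= row_sqnorm (state_mx gs t.+1 *m (1%:M - frame v r)) i) ||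
  (a ^+ 2 <= row_sqnorm ((invmx (state_mx gs t.+1))^T *m (1%:M - frame w u)) i).
have [/existsP[t /existsP[i /and3P[rt ia /orP b]]]|no] :=
  boolP [exists t : 'I_m, exists i : 'I_n, [&& is_rotation (tnth gs t),
     i \in affected (tnth gs t) & big t i]]; first by exists t, i.
suff : potential (F *m (1%:M - frame v r)) (F *m (1%:M - frame w u)) <=
  potential (1%:M - frame v r) (1%:M - frame w u) + m%:R * (8 * a ^+ 2) by lra.
rewrite -[X in potential _ (X *m _)]invF.
apply: potential_growth (sqr_ge0 a) _ => t i rt ia.
move: no; rewrite negb_exists => /forallP/(_ t).
rewrite negb_exists => /forallP/(_ i); rewrite rt ia /= /big negb_or -!ltNge.
by move=> /andP[/ltW ? /ltW ?].
Qed.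

Theorem theorem2 (R : realType) :
  exists c1 c2 : R, 0 < c1 /\ 0 < c2 /\
    forall (k m : nat) (gs : m.-tuple (gate R (2 ^ k))) (b : R),
      (0 < k)%N ->
      1 <= b ->
      m%:R = (2 ^ k)%:R * log2 (2 ^ k)%:R / b ->
      state_mx gs m = walsh_hadamard R k ->
      severe_overflow gs c1 c2 b \/ severe_underflow gs c1 c2 b.
Proof.
(* 1/900 is the trace threshold of the potential bounds. With 1/12, the m gates add at most n ln n /
   (18 ln 2), and 18 ln 2 >= 9 > 100/14. *)
exists (1 / 900), (1 / 12); do 2 (split; first by lra).
move=> k m gs b k0 b1 mE FE; set n := (2 ^ k)%N in gs mE FE *.
have n2 : (2 <= n)%N by rewrite -[2%N]expn1 leq_exp2l.
have N2 : 2 <= n%:R :> R by rewrite ler_nat.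
have L0 : 1 / 2 <= ln n%:R :> R by apply: ln_ge_half.
have l2 : 1 / 2 <= ln 2 :> R by apply: ln_ge_half.
pose a : R := 1 / 12 * Num.sqrt b.
have b0 : 0 < b by lra.
have a0 : 0 < a by rewrite mulr_gt0 ?sqrtr_gt0 //; lra.
have a2 : a ^+ 2 = b / 144.
  by rewrite exprMn sqr_sqrtr ?(ltW b0) //; field.
have small : m%:R * (8 * a ^+ 2) < n%:R * ln n%:R * (14 / 100).
  have -> : m%:R * (8 * a ^+ 2) = n%:R * ln n%:R / (18 * ln 2).
    by rewrite mE a2 /log2; field; rewrite !gt_eqF //; lra.
  by rewrite ltr_pM2l ?mulr_gt0 //; [rewrite invf_plt ?posrE; lra|lra|lra].
(* Provides the default time for the empty systems. *)
have m0 : (0 < m)%N.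
  rewrite -(ltr0n R) mE /log2 !mulr_gt0 ?invr_gt0 //; lra.
pose X t := (invmx (state_mx gs t))^T.
(* Each round adds one vector to one of the two systems unless a conclusion is already reached.
   After 2n rounds one system has at least n vectors, more than enough. *)
suff H N : (severe_overflow gs (1 / 900) (1 / 12) b \/
            severe_underflow gs (1 / 900) (1 / 12) b) \/
  exists r u, (r + u)%N = N /\
    (exists v t i alpha, growing_system gs (fun t => state_mx gs t) a r v t i alpha) /\
    (exists v t i alpha, growing_system gs X a u v t i alpha).
  have [//|[r [u [ru [[v [t [i [al sv]]]] [w [t' [i' [al' sw]]]]]]]]] := H (n + n)%N.
  have [nr|rn] := leqP n r.
    left; apply: (severe_growth_of_system a0 (erefl _) sv).
    have : n%:R <= r%:R :> R by rewrite ler_nat.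
    by lra.
  right; apply: (severe_growth_of_system a0 (erefl _) sw).
  have : n%:R <= u%:R :> R by rewrite ler_nat -(leq_add2l r) ru leq_add2r ltnW.
  by lra.
elim: N => [|N [|[r [u [ru [[v [t [i [al sv]]]] [w [t' [i' [al' sw]]]]]]]]]]; [|by left|].
  right; exists 0%N, 0%N; split=> //.
  have i0 : 'I_n by exists 0%N; rewrite expn_gt0.
  by split; exists (fun=> 0), (fun=> Ordinal m0), (fun=> i0), (fun=> 0).
(* A system of size n/900 already concludes; otherwise both traces are below the threshold and a
   large row extends one system. *)
have [rn|rn] := leP (1 / 900 * n%:R) (r%:R : R).
  by left; left; apply: (severe_growth_of_system a0 (erefl _) sv).
have [un|un] := leP (1 / 900 * n%:R) (u%:R : R).
  by left; right; apply: (severe_growth_of_system a0 (erefl _) sw).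
have [t0 [i0 [rot aff ext]]] : exists (t : 'I_m) i,
    [/\ is_rotation (tnth gs t), i \in affected (tnth gs t) &
    a ^+ 2 <= row_sqnorm (state_mx gs t.+1 *m (1%:M - frame v r)) i \/
    a ^+ 2 <= row_sqnorm (X t.+1 *m (1%:M - frame w u)) i].
  apply: row_sqnorm_bound => //; rewrite ?FE.
  - by case: sv.
  - by case: sw.
  - lra.
  - lra.
  - exact: walsh_hadamard_orthogonal.
  - exact: walsh_hadamard_sqr.
right; case: ext => ext.
  exists r.+1, u; split; first by rewrite addSn ru.
  split; first exact: (growing_system_extend a0 sv rot aff ext).
  by exists w, t', i', al'.
exists r, u.+1; split; first by rewrite addnS ru.
split; first by exists v, t, i, al.
exact: (growing_system_extend a0 sw rot aff ext).
Qed.
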